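(* Let $G$ be a graph, $\mathcal C$ a hole cover of $G$, $(\mathcal C_1,\dots,\mathcal C_{i(G)})$ a local chordalization partition of $\mathcal C$ with exactly $i(G)$ parts, and $G^*$ the last graph of the corresponding chordalization chain (with $G^*=G$ if $G$ is chordal). Then for every induced subgraph $H$ of $G$, $\omega(H^* )\le\omega(H)+i(G)$, where $H^*$ is the subgraph of $G^*$ induced by $V(H)$. Moreover, if $G$ is non-chordal and $K_n$-minor-free, then $\omega(G^* )\le n-2+i(G)$.
   Context: All graphs are finite and simple; $\omega$ is the clique number. A hole of $G$ is an induced cycle of length at least $4$; $G$ is chordal if it has no hole. $\mathcal H(G)$ is the set of holes and $\mathcal H(G,u)$ those containing $u$. A hole cover of $G$ is a nonempty $X\subseteq V(G)$ meeting every hole (any nonempty set if $G$ is chordal). A vertex $u$ satisfies the NC property in $G$ if there are no holes $H\in\mathcal H(G,u)$, $H'\in\mathcal H(G)\setminus\mathcal H(G,u)$ sharing two consecutive edges (two distinct edges with a common end vertex lying on both). A set $\mathcal C$ satisfies the NC property in $G$ if each of its vertices does and every hole contains at most one vertex of $\mathcal C$. Locally chordalizing all holes in $\mathcal H(G,u)$ by $u$ means adding all edges $uw$ with $w\ne u$ lying on some hole in $\mathcal H(G,u)$. For a hole cover $\mathcal C=\{u_1,\dots,u_k\}$ satisfying the NC property in $G$, set $G_0=G$, obtain $G_i$ from $G_{i-1}$ by locally chordalizing all holes in $\mathcal H(G_{i-1},u_i)$ by $u_i$, and put $\widehat G(\mathcal C)=G_k$ (independent of the ordering). Given a hole cover $\mathcal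 C$ of $G$, an ordered partition $(\mathcal C_1,\dots,\mathcal C_\ell)$ of $\mathcal C$ into nonempty parts is a local chordalization partition if, with $G_0=G_0^*=G-\mathcal C$ and, for $i=1,\dots,\ell$, $G_i$ the graph with $V(G_i)=V(G_{i-1}^* )\cup\mathcal C_i$ and $E(G_i)=E(G_{i-1}^* )\cup E\big(G-\bigcup_{j=i+1}^{\ell}\mathcal C_j\big)$ and $G_i^*=\widehat{G_i}(\mathcal C_i)$, each $\mathcal C_i$ is a hole cover of $G_i$ satisfying the NC property in $G_i$ and each $G_i^*$ is chordal; the sequence $G_0,G_0^*,\dots,G_\ell,G_\ell^*$ is the chordalization chain. The non-chordality index $i(G)$ is $0$ if $G$ is chordal and otherwise the smallest $\ell$ such that some hole cover of $G$ admits a local chordalization partition with $\ell$ parts. *)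

(* Defs.v *)
From mathcomp Require Import all_boot.
Set Implicit Arguments. Unset Strict Implicit. Unset Printing Implicit Defensive.

(* A finite simple graph: a vertex set inside a finite type T together with an
   edge relation; the actual adjacency is the symmetric, irreflexive closure of
   gE restricted to gV (see [adj]). Every finite simple graph is of this form. *)
Record graph (T : finType) := Graph { gV : {set T}; gE : rel T }.

Section Graphs.
Variable T : finType.
Implicit Types (g h : graph T) (S X C : {set T}) (u x y : T).

Definition adj g x y : bool :=
  [&& x \in gV g, y \in gV g, x != y & gE g x y || gE g y x].

Definition induced g S : graph T := Graph (gV g :&: S) (gE g).
Definition gdel g X : graph T := Graph (gV g :\: X) (gE g).

Definition is_hole g S : bool :=
  (3 < #|S|) &&
  [exists t : (#|S|).-tuple T,
     uniq t && ([set x in t] == S) &&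
     [forall i : 'I_#|S|, forall j : 'I_#|S|,
        adj g (tnth t i) (tnth t j) ==
        ((j == (i.+1 %% #|S|)%N :> nat) || (i == (j.+1 %% #|S|)%N :> nat))]].

Definition chordal g : bool := [forall S : {set T}, ~~ is_hole g S].

Definition hole_cover g X : bool :=
  [&& X != set0, X \subset gV g &
      [forall S : {set T}, is_hole g S ==> (S :&: X != set0)]].

(* two holes (of the same graph g, hence induced) share two consecutive edges *)
Definition share2 g S S' : bool :=
  [exists a, exists b, exists c,
     [&& a != c, adj g a b, adj g b c,
         a \in S :&: S', b \in S :&: S' & c \in S :&: S']].

Definition nc_vertex g u : bool :=
  ~~ [exists S : {set T}, exists S' : {set T},
        [&& is_hole g S, u \in S, is_hole g S', u \notin S' & share2 g S S']].

Definition nc_set g C : bool :=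
  [forall u in C, nc_vertex g u] &&
  [forall S : {set T}, is_hole g S ==> (#|S :&: C| <= 1)].

Definition locchord g u : graph T :=
  Graph (gV g) (fun x y => adj g x y ||
     ((x == u) && [exists S : {set T}, [&& is_hole g S, u \in S & y \in S]])).

(* \hat g(C): chordalize successively by the elements of C (in the order of
   enum C; the paper notes the result is independent of the ordering). *)
Definition hat g C : graph T := foldl locchord g (enum C).

Definition chainstep g (P : seq {set T}) (Gp : graph T) (n : nat) : graph T :=
  Graph (gV Gp :|: nth set0 P n)
        (fun x y => adj Gp x y ||
                    adj (gdel g (\bigcup_(Y <- drop n.+1 P) Y)) x y).

(* chainstar g C P i = G_i^* ; chainstep g P (chainstar g C P i) i = G_{i+1} *)
Fixpoint chainstar g C (P : seq {set T}) (n : nat) : graph T :=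
  match n with
  | 0 => gdel g C
  | n'.+1 => hat (chainstep g P (chainstar g C P n') n') (nth set0 P n')
  end.

Definition lcp g C (P : seq {set T}) : Prop :=
  hole_cover g C /\
  all (fun Y => Y != set0) P /\
  (forall i j, i < size P -> j < size P -> i != j ->
     [disjoint nth set0 P i & nth set0 P j]) /\
  \bigcup_(Y <- P) Y = C /\
  (forall i, i < size P ->
     let Gi := chainstep g P (chainstar g C P i) i in
     [/\ hole_cover Gi (nth set0 P i), nc_set Gi (nth set0 P i)
       & chordal (chainstar g C P i.+1)]).

Definition nc_index g (k : nat) : Prop :=
  (chordal g /\ k = 0) \/
  (~~ chordal g /\
   (exists C P, lcp g C P /\ size P = k) /\
   (forall C P, lcp g C P -> k <= size P)).

Definition is_clique g (K : {set T}) : bool :=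
  (K \subset gV g) && [forall x in K, forall y in K, (x != y) ==> adj g x y].

Definition omega g : nat := \max_(K : {set T} | is_clique g K) #|K|.

Definition has_Kminor g (n : nat) : Prop :=
  exists B : 'I_n -> {set T},
    (forall i, B i != set0 /\ B i \subset gV g) /\
    (forall i, forall x y, x \in B i -> y \in B i ->
        connect (adj (induced g (B i))) x y) /\
    (forall i j, i != j -> [disjoint B i & B j]) /\
    (forall i j, i != j -> exists x y, [/\ x \in B i, y \in B j & adj g x y]).

End Graphs.

(* Main.v *)
Require Import Defs.
From mathcomp Require Import all_boot zify.
Set Implicit Arguments. Unset Strict Implicit. Unset Printing Implicit Defensive.

(** Everything rests on one way of producing holes ([hole_of_sets]): if [z] sees
    two connected sets that do not touch each other, and both touch a connected
    set [W] avoiding the closed neighbourhood of [z], then some hole passes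
    through [z], both sets and [W].  Applied at an interior vertex of [H - u],
    with [H] a hole through an NC vertex [u], it shows that a connected set
    missing [u] touches the path [H - u] in an interval.  From this, a connected
    set [D] that lies on no hole through [u] and is not adjacent to [u] attaches
    to the neighbours of [u] and to the holes through [u] in a clique; hence
    local chordalization by [u] only destroys holes.

    Consequently all the new edges inside a clique of [hat g C] share one vertex
    of [C], so each step of the chain costs one vertex of a clique.  For the minor,
    undo all the steps but the first: the clique [K] left is complete in [g] except
    at one vertex [u], whose missing neighbours lie on holes through [u].  Each such
    hole has a side free of [K], so the component of [u] in [g - (K - u)] is a branch
    set that completes a [K_n]-minor with [n = #|K|]. *)

(** * Connected sets, closed neighbourhoods, and holes as lists *)

Section Connectivity.
Variables (T : finType) (g : graph T).
Implicit Types (x y z : T) (A B W S : {set T}) (s : seq T).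

Lemma adj_sym x y : adj g x y = adj g y x.
Proof. by rewrite /adj eq_sym orbC; case: (x \in _); case: (y \in _). Qed.

Lemma adj_irr x : adj g x x = false.
Proof. by rewrite /adj eqxx /= !andbF. Qed.

Lemma adj_neq x y : adj g x y -> x != y.
Proof. by case/and4P. Qed.

Lemma adj_induced W x y :
  adj (induced g W) x y = [&& adj g x y, x \in W & y \in W].
Proof.
by rewrite /adj /= !inE; case: (x \in W); case: (y \in W); rewrite ?andbT ?andbF.
Qed.

(** Reflexive on purpose: two sets with no such pair between them are disjoint as well as
    anticomplete. *)
Definition eq_or_adj x y := (x == y) || adj g x y.

Lemma nb_sym x y : eq_or_adj x y = eq_or_adj y x.
Proof. by rewrite /eq_or_adj eq_sym adj_sym. Qed.

Lemma nbxx x : eq_or_adj x x. Proof. by rewrite /eq_or_adj eqxx. Qed.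

Definition closed_nbhd W := [set x | [exists y in W, eq_or_adj x y]].

Lemma cnP W x : reflect (exists2 y, y \in W & eq_or_adj x y) (x \in closed_nbhd W).
Proof. by rewrite inE; apply: (iffP exists_inP). Qed.

Lemma cnI W x y : y \in W -> eq_or_adj x y -> x \in closed_nbhd W.
Proof. by move=> yW xy; apply/cnP; exists y. Qed.

Lemma sub_cn W x : x \in W -> x \in closed_nbhd W.
Proof. by move=> xW; apply: cnI xW (nbxx x). Qed.

Lemma cn1 x y : (x \in closed_nbhd [set y]) = eq_or_adj x y.
Proof.
apply/cnP/idP => [[z]|xy]; first by rewrite inE => /eqP ->.
by exists y; rewrite ?inE.
Qed.

Lemma cnU A B x : (x \in closed_nbhd (A :|: B)) = (x \in closed_nbhd A) || (x \in closed_nbhd B).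
Proof.
apply/cnP/orP => [[y]|[]/cnP[y yA xy]].
- by rewrite inE => /orP[yA|yB] xy; [left|right]; apply/cnP; exists y.
- by exists y => //; rewrite inE yA.
- by exists y => //; rewrite inE yA orbT.
Qed.

Definition conn W := forall x y, x \in W -> y \in W ->
  connect (adj (induced g W)) x y.

Lemma conn1 x : conn [set x].
Proof. by move=> a b; rewrite !inE => /eqP -> /eqP ->; apply: connect0. Qed.

Lemma connect_induced_sub A B x y : A \subset B ->
  connect (adj (induced g A)) x y -> connect (adj (induced g B)) x y.
Proof.
move=> /subsetP AB; apply: connect_sub => a b.
rewrite adj_induced => /and3P[ab /AB aB /AB bB].
by apply: connect1; rewrite adj_induced ab aB.
Qed.

Lemma connU A B x : conn A -> conn B -> x \in A -> x \in closed_nbhd B -> conn (A :|: B).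
Proof.
move=> cA cB xA /cnP[y yB xy].
have step (c d : T) : c \in A -> d \in B -> connect (adj (induced g (A :|: B))) c d.
  move=> cA' dB; apply: (connect_trans (connect_induced_sub (subsetUl A B) (cA _ _ cA' xA))).
  apply: connect_trans (connect_induced_sub (subsetUr A B) (cB _ _ yB dB)).
  case/orP: xy => [/eqP ->|xy]; first exact: connect0.
  by apply: connect1; rewrite adj_induced xy !inE xA yB orbT.
have sym : connect_sym (adj (induced g (A :|: B))).
  by apply: sym_connect_sym => a b; rewrite !adj_induced adj_sym andbCA andbC -andbA andbCA.
move=> a b; rewrite !inE => /orP[aA|aB] /orP[bA|bB].
- exact: connect_induced_sub (subsetUl A B) (cA _ _ aA bA).
- exact: step.
- by rewrite sym; exact: step.
- exact: connect_induced_sub (subsetUr A B) (cB _ _ aB bB).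
Qed.

Lemma set_seq_cons x s : [set y in x :: s] = x |: [set y in s].
Proof. by apply/setP=> y; rewrite !inE. Qed.

Lemma conn_seq s : sorted (adj g) s -> conn [set x in s].
Proof.
elim: s => [|x [|y s] IH] /=; first by move=> _ a b; rewrite !inE.
  by rewrite set_seq_cons => _ a b; rewrite !inE !orbF => /eqP -> /eqP ->; apply: connect0.
case/andP=> xy /IH cs; rewrite set_seq_cons.
apply: (@connU _ _ x) => //; first exact: conn1; first by rewrite inE.
by apply: (@cnI _ _ y); rewrite ?inE ?eqxx // /eq_or_adj xy orbT.
Qed.

Lemma is_holeP z S :
  reflect (exists t : seq T, [/\ 3 < size t, uniq t, [set x in t] = S &
     forall i j, i < size t -> j < size t -> adj g (nth z t i) (nth z t j) =
       ((j == i.+1 %% size t) || (i == j.+1 %% size t))])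
  (is_hole g S).
Proof.
apply: (iffP andP) => [[lt3 /existsP[t /andP[/andP[ut /eqP St] /forallP H]]]|[t [lt3 ut St H]]].
  exists t; split; rewrite ?size_tuple // => i j iS jS.
  have /forallP/(_ (Ordinal jS))/eqP := H (Ordinal iS).
  by rewrite !(tnth_nth z).
have eS : size t = #|S| by rewrite -St cardsE; apply/esym/card_uniqP.
split; first by rewrite -eS.
have szt : size t == #|S| by apply/eqP.
apply/existsP; exists (Tuple szt); rewrite /= ut St eqxx /=.
apply/forallP=> i; apply/forallP=> j; apply/eqP.
by rewrite !(tnth_nth z) /= H eS.
Qed.

(** Presents a hole as an apex [z] over an induced path; with [i < j] on the path, the wrap-around
    of the cycle only concerns [z]. *)
Lemma hole_build z s : 2 < size s -> uniq s -> z \notin s ->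
  (forall i j, i < j -> j < size s -> adj g (nth z s i) (nth z s j) = (j == i.+1)) ->
  (forall i, i < size s -> adj g z (nth z s i) = (i == 0) || (i == (size s).-1)) ->
  is_hole g [set x in z :: s].
Proof.
move=> s2 us zs H Hz; apply/(is_holeP z); exists (z :: s).
have modS i : i < (size s).+1 -> i.+1 %% (size s).+1 = if i == size s then 0 else i.+1.
  by case: eqP => [->|ne] lt; [rewrite modnn | rewrite modn_small; lia].
split=> //=; first by rewrite zs us.
have sy i j : i < j -> j < (size s).+1 -> adj g (nth z (z :: s) i) (nth z (z :: s) j) =
       ((j == i.+1 %% (size s).+1) || (i == j.+1 %% (size s).+1)).
  case: j => // j ij js; rewrite !modS; [|lia|lia].
  case: i ij => [|i] ij /=.
    rewrite Hz //; case: (size s) s2 js => // n; case: j {ij} => [|j] n2 jn; do !case: eqP; lia.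
  by rewrite H; [do !case: eqP; lia|lia|lia].
move=> i j si sj; case: (ltngtP i j) => [ij|ij|->].
- exact: sy.
- by rewrite adj_sym sy // orbC.
- by rewrite adj_irr !modS //; do !case: eqP; lia.
Qed.

End Connectivity.

(** * Producing holes from connected sets *)

Section Holes.
Variables (T : finType) (g : graph T).
Implicit Types (x y z u : T) (A B W X S : {set T}) (s p q : seq T).

(** Rotating the cyclic order until [u] comes first leaves an induced path whose ends are the two
    neighbours of [u]. *)
Lemma hole_split u S : is_hole g S -> u \in S ->
  exists q, [/\ 2 < size q, uniq (u :: q), [set x in u :: q] = S,
   forall i j, i < j -> j < size q -> adj g (nth u q i) (nth u q j) = (j == i.+1) &
   forall i, i < size q -> adj g u (nth u q i) = (i == 0) || (i == (size q).-1)].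
Proof.
move=> /(is_holeP g u)[t [t3 ut tS H]] uS.
have ut' : u \in t by move: uS; rewrite -tS inE.
set k := index u t; have kt : k < size t by rewrite index_mem.
set q := drop k.+1 t ++ take k t.
have eq : rot k t = u :: q by rewrite /k rot_index.
have sq : (size q).+1 = size t by rewrite -(size_rot k t) eq.
have nq i : i < size t -> nth u (u :: q) i = nth u t (if i + k < size t then i + k else i + k - size t).
  move=> it; rewrite -eq /rot nth_cat size_drop nth_drop.
  case: (ltnP i (size t - k)) => c; case: (ltnP (i + k) (size t)) => c'; try lia.
    by rewrite addnC.
  rewrite nth_take; last lia.
  by congr nth; lia.
have modS i : i < size t -> i.+1 %% size t = if i.+1 == size t then 0 else i.+1.
  by case: eqP => [->|ne] lt; [rewrite modnn | rewrite modn_small; lia].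
have Hq i j : i < j -> j < size t -> adj g (nth u (u :: q) i) (nth u (u :: q) j) =
    (j == i.+1) || (i == 0) && (j.+1 == size t).
  move=> ij jt; rewrite !nq; [|lia|lia].
  by case: ifP => ci; case: ifP => cj; rewrite H; try lia;
    rewrite !modS; try lia; do ?case: ifP; lia.
exists q; split; first lia.
- by rewrite -eq rot_uniq.
- by apply/setP=> x; rewrite -eq -tS !inE mem_rot.
- move=> i j ij jq; have /= -> := Hq i.+1 j.+1 ij; last lia.
  by rewrite orbF.
- by move=> i iq; have /= -> := Hq 0 i.+1 isT; lia.
Qed.

(** Index-free way to say that a path is induced: removing any vertex leaves two sides that do not
    touch. *)
Definition anticomplete_parts q := forall pre a post, q = pre ++ a :: post ->
  forall x y, x \in pre -> y \in post -> ~~ eq_or_adj g x y.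

Lemma hole_path u S : is_hole g S -> u \in S ->
  exists q, [/\ [set x in u :: q] = S, uniq (u :: q), sorted (adj g) q,
   anticomplete_parts q &
   [/\ exists a m b, q = a :: rcons m b /\ m != [::],
   forall s1 s2, q = s1 ++ s2 -> s1 != [::] -> exists2 x, x \in s1 & adj g u x,
   forall s1 s2, q = s1 ++ s2 -> s2 != [::] -> exists2 x, x \in s2 & adj g u x &
   forall pre a post, q = pre ++ a :: post -> pre != [::] -> post != [::] -> ~~ adj g u a]].
Proof.
move=> hS uS; have [q [q2 /andP[uq uniq_q] qS H Hu]] := hole_split hS uS.
exists q; split=> //; first by rewrite /= uq.
- by apply/(sortedP u) => i iq; rewrite H //= eqxx.
- move=> pre a post eq x y xpre ypost.
  have sq : size q = size pre + (size post).+1 by rewrite eq size_cat.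
  have [i xi ex] : exists2 i, i < size pre & nth u q i = x.
    by exists (index x pre); rewrite ?index_mem // eq nth_cat index_mem xpre nth_index.
  have [j yj ey] : exists2 j, j < size post & nth u q (size pre + j.+1) = y.
    exists (index y post); first by rewrite index_mem.
    by rewrite eq nth_cat ltnNge leq_addr /= addKn /= nth_index.
  have iq : i < size q by rewrite sq ltn_addr.
  have jq : size pre + j.+1 < size q by rewrite sq ltn_add2l.
  have ij : i < size pre + j.+1 by rewrite ltn_addr.
  rewrite negb_or -ex -ey nth_uniq // H // (ltn_eqF ij) /=.
  by rewrite addnS eqSS gtn_eqF // ltn_addr.
- split.
  + case: q q2 {uq uniq_q qS H Hu} => // a q; case/lastP: q => // m b.
    by rewrite /= size_rcons => m0; exists a, m, b; split=> //; case: m m0.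
  + move=> [//|x s1] s2 eq _; exists x; first by rewrite inE eqxx.
    by have := Hu 0; rewrite eq /= => -> //.
  + move=> s1 s2; case/lastP: s2 => // s2 x eq _; exists x; first by rewrite mem_rcons inE eqxx.
    have sq : size q = size s1 + (size s2).+1 by rewrite eq size_cat size_rcons.
    have -> : x = nth u q (size q).-1 by rewrite nth_last eq last_cat last_rcons.
    by rewrite Hu ?eqxx ?orbT //; lia.
  + move=> [//|x pre] a [//|y post] eq _ _.
    have sq : size q = (size pre + (size post)).+3 by rewrite eq /= size_cat /= !addnS.
    have -> : a = nth u q (size pre).+1 by rewrite eq /= nth_cat ltnn subnn.
    by rewrite Hu sq /= ?eqSS ?ltnS ?leqW ?leq_addr // ltn_eqF // ltnS leq_addr.
Qed.

(** A walk in [X] between neighbours of [z], from [A] to [B]. Repetitions and chords are allowed; a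
    shortest such walk has none. *)
Definition link A B X z s :=
  [&& sorted (adj g) s, all (mem X) s, s != [::],
   (head z s \in A) && adj g z (head z s) & (last z s \in B) && adj g z (last z s)].

Lemma link_cut A B X z s i j : link A B X z s -> i < j -> j < size s ->
  (if i is i'.+1 then adj g (nth z s i') (nth z s j)
   else (nth z s j \in A) && adj g z (nth z s j)) ->
  link A B X z (take i s ++ drop j s).
Proof.
case/and5P=> so al _ hd la ij js H.
have [y [t ed]] : exists y t, drop j s = y :: t.
  by case: (drop j s) (size_drop j s) => [|y t] //= e; [lia|exists y, t].
have ny : nth z s j = y by rewrite -[j]addn0 -nth_drop ed.
have al' : all (mem X) (take i s ++ drop j s).
  by apply/allP=> x; rewrite mem_cat => /orP[/mem_take|/mem_drop] xs; apply: (allP al).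
apply/and5P; split=> //.
- have pyt : path (adj g) y t by have := drop_sorted j so; rewrite ed.
  rewrite ed; case: i ij H {al'} => [|i'] ij; first by rewrite take0.
  rewrite ny => H; have i's : i' < size s by lia.
  rewrite (take_nth z i's) cat_rcons sorted_cat_cons /= H pyt !andbT.
  by rewrite -(take_nth z i's) take_sorted.
- by rewrite ed; case: (take i s).
- case: i ij H {al'} => [|i'] ij H; first by rewrite take0 cat0s ed /= -ny.
  by case: s {al so la ed ny H} hd js => //= x s; rewrite ?ltn0.
- rewrite last_cat ed /=; suff -> : last y t = last z s by [].
  by rewrite -(cat_take_drop j s) last_cat ed.
Qed.

Lemma link_take A B X z s i : link A B X z s -> i < size s ->
  nth z s i \in B -> adj g z (nth z s i) -> link A B X z (take i.+1 s).
Proof.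
case/and5P=> so al _ hd la is_ iB zi; apply/and5P; split.
- exact: take_sorted.
- by apply/allP=> x /mem_take xs; apply: (allP al).
- by case: s {so al hd la iB zi} is_.
- by case: s {so al la iB zi} is_ hd.
- by rewrite (take_nth z is_) last_rcons iB.
Qed.

Lemma path_induced_all X x p :
  path (adj (induced g X)) x p -> path (adj g) x p && all (mem X) p.
Proof.
elim: p x => //= y p IH x /andP[]; rewrite adj_induced => /and3P[-> _ yX] /IH.
by case/andP=> -> ->; rewrite yX.
Qed.

(** A shortest link in the union of the three sets is an induced path with only its ends adjacent to
    [z], so it closes up to a hole through [z]. It must use [W], because [A] and [B] do not
    touch. *)
Lemma hole_of_sets z A B W :
  conn g A -> conn g B -> conn g W -> z \notin A -> z \notin B -> z \notin closed_nbhd g W ->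
  (forall x y, x \in A -> y \in B -> ~~ eq_or_adj g x y) ->
  (exists2 x, x \in A & adj g z x) -> (exists2 x, x \in B & adj g z x) ->
  (exists2 x, x \in A & x \in closed_nbhd g W) -> (exists2 x, x \in B & x \in closed_nbhd g W) ->
  exists S, [/\ is_hole g S, z \in S, S \subset z |: (A :|: B :|: W) &
    [/\ exists2 x, x \in S :&: A & adj g z x, exists2 x, x \in S :&: B & adj g z x
      & exists x, x \in S :&: W]].
Proof.
move=> cA cB cW zA zB zW AB [a aA za] [b bB zb] [a' a'A a'W] [b' b'B b'W].
set X := A :|: B :|: W.
have cX : conn g X.
  rewrite /X (setUC A B) -setUA; apply: (connU (x := b')) => //.
    exact: (connU (x := a')).
  by rewrite cnU b'W orbT.
have zX : z \notin X.
  rewrite !inE (negPf zA) (negPf zB) /=.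
  by apply: contra zW; apply: sub_cn.
have [n Pn minP] : exists2 n, [exists t : n.-tuple T, link A B X z t] &
    forall s, link A B X z s -> n <= size s.
  have ex : exists n, [exists t : n.-tuple T, link A B X z t].
    have /connectP[p pp eb] := cX a b (subsetP (subsetUl _ _) _ (subsetP (subsetUl _ _) _ aA))
        (subsetP (subsetUl _ _) _ (subsetP (subsetUr _ _) _ bB)).
    case/andP: (path_induced_all pp) => pg pX.
    exists (size p).+1; apply/existsP; exists (in_tuple (a :: p)).
    by rewrite /link /= pg pX -eb !inE aA za bB zb.
  case: (ex_minnP ex) => n Pn minP; exists n => // s ls.
  by apply: minP; apply/existsP; exists (in_tuple s).
case/existsP: Pn => t; move: (size_tuple t); move: (tval t) => {t} s sn ls.
rewrite -{n}sn in minP.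
case/and5P: (ls) => so al s0 /andP[hA zh] /andP[lB zl].
have nocut i j : i < j -> j < size s ->
  (if i is i'.+1 then adj g (nth z s i') (nth z s j)
   else (nth z s j \in A) && adj g z (nth z s j)) -> False.
  move=> ij js H; have := minP _ (link_cut ls ij js H).
  by rewrite size_cat size_take_min size_drop; clear -ij js; lia.
have notake i : i.+1 < size s -> nth z s i \in B -> adj g z (nth z s i) -> False.
  move=> is_ iB zi; have := minP _ (link_take ls (ltnW is_) iB zi).
  by rewrite size_take_min; clear -is_; lia.
have sadj i : i.+1 < size s -> adj g (nth z s i) (nth z s i.+1) by move/sortedP: so; apply.
have h0 : head z s = nth z s 0 by rewrite nth0.
have hl : last z s = nth z s (size s).-1 by rewrite nth_last.
have us : uniq s.
  apply: contraT => /(uniqPn z)[i [j [ij js e]]]; case: (nocut i j ij js).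
  rewrite -e; case: i ij {e} => [|i] ij; first by rewrite -h0 hA.
  by apply: sadj; apply: ltn_trans js.
have H i j : i < j -> j < size s -> adj g (nth z s i) (nth z s j) = (j == i.+1).
  move=> ij js; case: eqP => [e|/eqP ne]; first by rewrite e sadj // -e.
  by apply/negP => H; apply: (nocut i.+1 j) => //; rewrite ltn_neqAle eq_sym ne.
have zs : z \notin s by apply: contra zX => /(allP al).
have sX i : i < size s -> nth z s i \in X by move=> is_; apply: (allP al); apply: mem_nth.
(* An interior neighbour of [z] would be a better start if it lies in [A], a better end if it lies
   in [B], and cannot lie in [W]. *)
have Hz i : i < size s -> adj g z (nth z s i) = (i == 0) || (i == (size s).-1).
  move=> is_; case: eqP => [->|/eqP i0] /=; first by rewrite -h0.
  case: eqP => [->|/eqP il] /=; first by rewrite -hl.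
  apply/negP=> zi; have := sX i is_; rewrite !inE => /orP[/orP[iA|iB]|iW].
  - by apply: (nocut 0 i) => //; [rewrite lt0n | rewrite iA].
  - by apply: (notake i) => //; clear -is_ il; lia.
  - by case/negP: zW; apply: (cnI iW); rewrite /eq_or_adj zi orbT.
(* Without [W], the walk starts in [A] and can never step into [B]. *)
have [w ws wW] : exists2 w, w \in s & w \in W.
  apply/exists_inP; apply: contraT; rewrite negb_exists_in => /forall_inP nW.
  have sA i : i < size s -> nth z s i \in A.
    elim: i => [|i IH] is_; first by rewrite -h0.
    have := sX _ is_; rewrite !inE (negPf (nW _ (mem_nth z is_))) orbF.
    case/orP=> // iB; have := AB _ _ (IH (ltnW is_)) iB.
    by rewrite /eq_or_adj sadj // orbT.
  have lts : (size s).-1 < size s by case: (s) s0.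
  by have := AB _ _ (sA _ lts) lB; rewrite hl nbxx.
(* With one or two vertices, the ends of the walk would make [A] touch [B]. *)
have s2 : 2 < size s.
  case: (s) s0 hA zh lB zl H => [//|x [|y [|//]]] /= _ hA zh lB zl H.
  - by have := AB _ _ hA lB; rewrite nbxx.
  - by have := AB _ _ hA lB; rewrite /eq_or_adj (H 0 1) // orbT.
exists [set x in z :: s]; split; first exact: hole_build.
- by rewrite !inE eqxx.
- by apply/subsetP=> x; rewrite in_set in_cons in_setU1 => /orP[->//|/(allP al) xX]; apply/orP; right.
split.
- exists (head z s) => //; rewrite !inE hA andbT.
  by rewrite h0 mem_nth ?orbT // (ltnW (ltnW s2)).
- exists (last z s) => //; rewrite !inE lB andbT.
  by rewrite hl mem_nth ?orbT //; case: (s) s0.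
- by exists w; rewrite !inE ws wW orbT.
Qed.

End Holes.

(** * Traces of holes at a vertex and their interval property *)

Section Loops.
Variables (T : finType) (g : graph T).
Implicit Types (x y z u : T) (A B D W S : {set T}) (s p q : seq T).

(* The traces at [u]: [H - u] for a hole [H] through [u], or a single neighbour of [u]. *)
Record loop u q : Prop := Loop {
  loop_notin : u \notin q;
  loop_sorted : sorted (adj g) q;
  loop_anti : anticomplete_parts g q;
  loop_endl : forall s1 s2, q = s1 ++ s2 -> s1 != [::] ->
    exists2 x, x \in s1 & adj g u x;
  loop_endr : forall s1 s2, q = s1 ++ s2 -> s2 != [::] ->
    exists2 x, x \in s2 & adj g u x;
  loop_gap : forall pre a post, q = pre ++ a :: post ->
    forall W x y, conn g W -> u \notin W -> x \in pre -> x \in closed_nbhd g W ->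
    y \in post -> y \in closed_nbhd g W -> a \in closed_nbhd g W }.

Lemma loop_rev u q : loop u q -> loop u (rev q).
Proof.
have rv pre a post : rev q = pre ++ a :: post -> q = rev post ++ a :: rev pre.
  by move/(congr1 rev); rewrite revK rev_cat rev_cons cat_rcons.
case=> uq so an el er gap; split.
- by rewrite mem_rev.
- by rewrite rev_sorted; congr is_true: so; apply: eq_sorted => x y; rewrite adj_sym.
- by move=> pre a post /rv/an H x y xp yp; rewrite nb_sym H ?mem_rev.
- move=> s1 s2 /(congr1 rev); rewrite revK rev_cat => /er H s0.
  have [|x xs ux] := H; first by rewrite -size_eq0 size_rev size_eq0.
  by exists x; rewrite // -mem_rev.
- move=> s1 s2 /(congr1 rev); rewrite revK rev_cat => /el H s0.
  have [|x xs ux] := H; first by rewrite -size_eq0 size_rev size_eq0.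
  by exists x; rewrite // -mem_rev.
- move=> pre a post /rv/gap H W x y cW uW xp xW yp yW.
  by apply: (H W y x); rewrite ?mem_rev.
Qed.

(** Lets old neighbours of [u] be treated like holes through [u]: the conditions on two nonempty
    sides are vacuous. *)
Lemma loop1 u b : adj g u b -> loop u [:: b].
Proof.
move=> ub; split=> //.
- by rewrite inE (adj_neq ub).
- by case=> [|? []].
- by case=> [//|x s1] s2 [<-] _ _; exists b; rewrite ?inE ?eqxx.
- case=> [|x [|y s1]] [|z s2] //= [].
    by move=> <- <- _; exists b; rewrite ?inE ?eqxx.
- by case=> [|? []].
Qed.

(** The NC property is what yields [loop_gap]. If [W] touches both sides of [a] but not [a], then
    [hole_of_sets] at [a] gives a hole avoiding [u] that contains both path neighbours of [a], hence
    shares two consecutive edges with [S]. *)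
Lemma loop_hole u S : nc_vertex g u -> is_hole g S -> u \in S ->
  exists q, loop u q /\ [set x in u :: q] = S.
Proof.
move=> nc hS uS; have [q [eS uuq so an [_ el er _]]] := hole_path hS uS.
move: uuq; rewrite cons_uniq => /andP[uq uq'].
exists q; split=> //; split=> // pre a post eq W x y cW uW xpre xW ypost yW.
apply: contraT => aW.
move: (so); rewrite eq => /cat_sorted2[spre sp].
have spost : sorted (adj g) post by apply: path_sorted sp.
have [anpre anpost] : a \notin pre /\ a \notin post.
  by move: uq'; rewrite eq cat_uniq /= negb_or => /and3P[_ /andP[-> _] /andP[-> _]].
have apre : exists2 c, c \in [set v in pre] & adj g a c.
  case/lastP: pre eq xpre {spre anpre} => // pre c eq _; exists c.
    by rewrite inE mem_rcons inE eqxx.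
  by move: so; rewrite eq -cats1 -catA sorted_cat_cons => /andP[_] /= /andP[]; rewrite adj_sym.
have apost : exists2 c, c \in [set v in post] & adj g a c.
  by case: post {eq spost anpost} ypost sp => // c post _ /= /andP[ac _]; exists c; rewrite ?inE ?eqxx.
have := @hole_of_sets _ g a _ _ W (conn_seq spre) (conn_seq spost) cW _ _ aW _ apre apost.
rewrite !inE => /(_ anpre anpost).
case.
- by move=> v w; rewrite !inE; apply: (an _ _ _ eq).
- by exists x; rewrite ?inE // in xW *.
- by exists y; rewrite ?inE // in yW *.
move=> S' [hS' aS' S'sub [[c /setIP[cS' cpre] ac] [d /setIP[dS' dpost] ad] _]].
rewrite !inE in cpre dpost.
have uS' : u \notin S'.
  apply: contra uq => /(subsetP S'sub); rewrite !inE (negPf uW) orbF eq mem_cat inE.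
  by case: (u \in pre); rewrite ?orbT.
case/negP: nc; apply/existsP; exists S; apply/existsP; exists S'.
rewrite hS uS hS' uS' /=; apply/existsP; exists c; apply/existsP; exists a; apply/existsP; exists d.
rewrite (adj_sym g c) ac ad !in_setI cS' aS' dS' -eS !inE eq !mem_cat !inE cpre dpost eqxx ?orbT !andbT /=.
by have := an _ _ _ eq _ _ cpre dpost; rewrite negb_or => /andP[].
Qed.

Lemma split_last_has (P : pred T) s : has P s ->
  exists l c r, [/\ s = l ++ c :: r, P c & ~~ has P r].
Proof.
elim: s => //= x s IH; case: (boolP (has P s)) => [/IH[l [c [r [-> Pc nr]]]] _|ns].
  by exists (x :: l), c, r.
by rewrite orbF => Px; exists [::], x, s.
Qed.

Definition sset s := [set x in s].

Lemma ssetE s x : (x \in sset s) = (x \in s). Proof. by rewrite inE. Qed.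

Lemma notin_cn s x : x \notin closed_nbhd g (sset s) -> forall y, y \in s -> eq_or_adj g x y = false.
Proof. by move=> xs y ys; apply: contraNF xs => xy; apply: (cnI _ xy); rewrite ssetE. Qed.

Lemma notin_cnI s x : (forall y, y \in s -> eq_or_adj g x y = false) -> x \notin closed_nbhd g (sset s).
Proof. by move=> H; apply/negP => /cnP[y]; rewrite ssetE => /H ->. Qed.

(** If [b] touched both sides of [a], the interval property for [[set b]] would make it touch [a].
    The free side is made final by reversing the path when necessary. *)
Lemma free_side u p a b : loop u p -> a \in p -> u != b -> ~~ eq_or_adj g a b ->
  exists p' pre post, [/\ loop u p', p' = pre ++ a :: post &
    b \notin closed_nbhd g (sset (a :: post))].
Proof.
move=> lp ap ub ab.
have [pre [post ep]] : exists pre post, p = pre ++ a :: post.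
  by case/splitPr: ap => p1 p2; exists p1, p2.
case: (boolP (b \in closed_nbhd g (sset (a :: post)))) => [|bA]; last by exists p, pre, post.
case/cnP=> y; rewrite ssetE inE => /predU1P[->|yp by_]; first by rewrite nb_sym (negPf ab).
exists (rev p), (rev post), (rev pre); split; first exact: loop_rev.
  by rewrite ep rev_cat rev_cons cat_rcons.
apply: notin_cnI => x; rewrite inE mem_rev nb_sym => /predU1P[->|xp]; first exact: negPf.
apply: contraNF ab => xb; rewrite -cn1.
apply: (loop_gap lp ep (conn1 g (x := b)) _ xp _ yp); rewrite ?cn1 ?inE //.
by rewrite nb_sym.
Qed.

(** * Contacts of a connected set with the traces at a vertex *)

Variables (u : T) (D : {set T}).
Hypotheses (cD : conn g D) (uD : u \notin closed_nbhd g D).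
Hypothesis noD : forall S x, is_hole g S -> u \in S -> x \in S -> x \notin D.

Lemma notinD_u x : x \in closed_nbhd g D -> u != x.
Proof. by move=> xD; apply: contraNneq uD => ->. Qed.

Lemma u_notinD : u \notin D.
Proof. by apply: contra uD; apply: sub_cn. Qed.

(** Each side of [a] contains a neighbour of [u], so contacts with [D] on both sides would give a
    hole through [u] and [D]. *)
Lemma loop_far q pre a post x y : loop u q -> q = pre ++ a :: post ->
  x \in pre -> x \in closed_nbhd g D -> y \in post -> y \in closed_nbhd g D -> False.
Proof.
move=> [uq so an el er _] eq xpre xD ypost yD.
move: (so); rewrite eq => /cat_sorted2[spre sp].
have spost : sorted (adj g) post by apply: path_sorted sp.
move: uq; rewrite eq mem_cat inE !negb_or => /and3P[upre _ upost].
have [|||||||S [hS uS _ [_ _ [w /setIP[wS wD]]]]] :=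
  @hole_of_sets _ g u _ _ D (conn_seq spre) (conn_seq spost) cD _ _ uD.
- by rewrite inE.
- by rewrite inE.
- by move=> v w; rewrite !inE; apply: (an _ _ _ eq).
- have [|v vp uv] := el _ _ eq; first by case: (pre) xpre.
  by exists v; rewrite ?inE.
- have [||v vp uv] := er (rcons pre a) post.
  + by rewrite cat_rcons.
  + by case: (post) ypost.
  by exists v; rewrite ?inE.
- by exists x; rewrite // inE.
- by exists y; rewrite // inE.
by case/negP: (noD hS uS wS).
Qed.

(* A final segment of a trace, directed away from its last contact with [D]. *)
Definition arm p al post := [/\ exists2 pre, loop u p & p = pre ++ al :: post,
  al \in closed_nbhd g D & forall x, x \in post -> x \notin closed_nbhd g D].

Lemma arm_conn p al post : arm p al post -> conn g (sset (al :: post)).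
Proof.
by case=> [[pre [_ so _ _ _ _] eq] _ _]; move: so; rewrite eq => /cat_sorted2[_]; apply: conn_seq.
Qed.

(* The arms must touch, since otherwise [hole_of_sets] gives a hole through [u] and [D];
   the interval property then moves the contact down to the second vertices. *)
Lemma arms_meet p q al post be post' : arm p al post -> arm q be post' ->
  al \notin closed_nbhd g (sset (be :: post')) -> be \notin closed_nbhd g (sset (al :: post)) ->
  exists a1 t b1 t', [/\ post = a1 :: t, post' = b1 :: t' & eq_or_adj g a1 b1].
Proof.
move=> Ha Hb al_B be_A.
have [cA cB] := (arm_conn Ha, arm_conn Hb).
case: Ha => [[pre lp ep] alD nA]; case: Hb => [[pre' lq eq] beD nB].
have [uA uB] : u \notin al :: post /\ u \notin be :: post'.
  split; [have := loop_notin lp; rewrite ep | have := loop_notin lq; rewrite eq];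
  by rewrite mem_cat negb_or => /andP[].
have alb := notin_cn al_B; have bea := notin_cn be_A.
have [x [y [xA yB xy]]] : exists x y, [/\ x \in post, y \in post' & eq_or_adj g x y].
  case: (boolP [exists x in al :: post, exists y in be :: post', eq_or_adj g x y]).
    case/exists_inP=> x xA /exists_inP[y yB xy]; exists x, y; split=> //.
      by move: xA; rewrite inE => /predU1P[ex|//]; rewrite ex alb in xy.
    by move: yB; rewrite inE => /predU1P[ey|//]; rewrite ey nb_sym bea in xy.
  move=> H.
  have [|||||||S [hS uS _ [_ _ [w /setIP[wS wD]]]]] :=
    @hole_of_sets _ g u _ _ D cA cB cD _ _ uD.
  - by rewrite ssetE.
  - by rewrite ssetE.
  - move=> x y; rewrite !ssetE => xA yB; apply: contra H => xy.
    by apply/exists_inP; exists x => //; apply/exists_inP; exists y.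
  - by have [//|v vp uv] := loop_endr lp ep; exists v; rewrite ?ssetE.
  - by have [//|v vp uv] := loop_endr lq eq; exists v; rewrite ?ssetE.
  - by exists al; rewrite // ssetE inE eqxx.
  - by exists be; rewrite // ssetE inE eqxx.
  by have := noD hS uS wS; rewrite wD.
case: post uA ep nA xA cA be_A bea => // a1 t uA ep nA xA cA be_A bea.
case: post' uB eq nB yB cB al_B alb => // b1 t' uB eq nB yB cB al_B alb.
exists a1, t, b1, t'; split=> //.
have a1B : a1 \in closed_nbhd g (sset [:: be, b1 & t']).
  suff : a1 \in closed_nbhd g (sset [:: be, b1 & t'] :|: D).
    by rewrite cnU (negPf (nA a1 (mem_head _ _))) orbF.
  have xB : x \in closed_nbhd g (sset [:: be, b1 & t'] :|: D).
    by rewrite cnU (cnI _ xy) // ssetE inE yB orbT.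
  move: xA; rewrite inE => /predU1P[<- //|xt].
  apply: (loop_gap lp (pre := rcons pre al) (a := a1) (post := t) _ _ _ _ _ xt xB (x := al)).
  - by rewrite cat_rcons.
  - by apply: (connU (x := be)) => //; rewrite ssetE inE eqxx.
  - by rewrite inE ssetE negb_or uB u_notinD.
  - by rewrite mem_rcons inE eqxx.
  - by rewrite cnU alD orbT.
case/cnP: a1B => y'; rewrite ssetE inE => /predU1P[->|y'B] a1y'.
  by rewrite nb_sym bea // in a1y'; rewrite !inE eqxx orbT.
move: y'B; rewrite inE => /predU1P[<- //|y't].
have salp : sorted (adj g) [:: al; a1].
  by move: (loop_sorted lp); rewrite ep => /cat_sorted2[_] /= /andP[->].
have : b1 \in closed_nbhd g (sset [:: al; a1] :|: D).
  apply: (loop_gap lq (pre := rcons pre' be) (a := b1) (post := t') _ _ _ _ _ y't (x := be)).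
  - by rewrite cat_rcons.
  - by apply: (connU (x := al) (conn_seq salp)) => //; rewrite ssetE inE eqxx.
  - rewrite inE ssetE negb_or u_notinD andbT.
    by move: uA; rewrite !inE !negb_or => /and3P[-> ->].
  - by rewrite mem_rcons inE eqxx.
  - by rewrite cnU beD orbT.
  - by rewrite cnU (cnI (y := a1)) // ?ssetE ?inE ?eqxx ?orbT // nb_sym.
rewrite cnU (negPf (nB b1 (mem_head _ _))) orbF => /cnP[z]; rewrite ssetE !inE.
case/orP=> /eqP->; last by rewrite nb_sym.
by rewrite nb_sym alb // !inE eqxx orbT.
Qed.

(** Moves from [a] forward to the last contact with [D]. The final disjunction records that [a] is
    not lost beyond [al], so that one can return to it. *)
Lemma arm_exists1 p pre a post b : loop u p -> p = pre ++ a :: post -> a \in closed_nbhd g D ->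
  b \notin closed_nbhd g (sset (a :: post)) ->
  exists pre al post, [/\ p = pre ++ al :: post, arm p al post,
    b \notin closed_nbhd g (sset (al :: post)) & (a == al) || (a \in pre)].
Proof.
move=> lp ep aD bA; case: (boolP (has (mem (closed_nbhd g D)) post)) => [|np].
  case/split_last_has=> l [c [r [er cD' nr]]].
  exists (pre ++ a :: l), c, r; split.
  - by rewrite ep er -catA.
  - split=> //; first by exists (pre ++ a :: l) => //; rewrite ep er -catA.
    by move=> x xr; apply: contra nr => xD; apply/hasP; exists x.
  - apply: notin_cnI => y yr; apply: (notin_cn bA).
    by rewrite er inE mem_cat yr !orbT.
  - by rewrite mem_cat inE eqxx !orbT.
exists pre, a, post; split; rewrite ?eqxx //.
split=> //; first by exists pre.
by move=> x xr; apply: contra np => xD; apply/hasP; exists x.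
Qed.

Lemma arm_exists p a b : loop u p -> a \in p -> a \in closed_nbhd g D -> b \in closed_nbhd g D ->
  ~~ eq_or_adj g a b ->
  exists p' pre al post, [/\ loop u p', p' = pre ++ al :: post, arm p' al post,
    b \notin closed_nbhd g (sset (al :: post)) & (a == al) || (a \in pre)].
Proof.
move=> lp ap aD bD ab.
have [p' [pre [post [lp' ep bA]]]] := free_side lp ap (notinD_u bD) ab.
by have [pre' [al [post' [? ? ? ?]]]] := arm_exists1 lp' ep aD bA; exists p', pre', al, post'.
Qed.

(** Arms are chosen one after the other, each free of the starting contact of the other. Only [be]
    may still touch the first arm; in that case the second arm is replaced by the one leaving [b] in
    the opposite direction. *)
Lemma arms_exist p q a b : loop u p -> loop u q -> a \in p -> b \in q ->
  a \in closed_nbhd g D -> b \in closed_nbhd g D -> ~~ eq_or_adj g a b ->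
  exists p' q' al post be post', [/\ arm p' al post, arm q' be post',
    al \notin closed_nbhd g (sset (be :: post')) & be \notin closed_nbhd g (sset (al :: post))].
Proof.
move=> lp lq ap bq aD bD ab.
have [p' [pre [al [post [lp' ep arma bA _]]]]] := arm_exists lp ap aD bD ab.
have alb : ~~ eq_or_adj g b al by rewrite (notin_cn bA) // inE eqxx.
have alD : al \in closed_nbhd g D by case: arma.
have [q' [pre' [be [post' [lq' eq armb alB bpre]]]]] := arm_exists lq bq bD alD alb.
case: (boolP (be \in closed_nbhd g (sset (al :: post)))) => [|beA]; last by exists p', q', al, post, be, post'.
have beD : be \in closed_nbhd g D by case: armb.
have nA : forall x, x \in post -> x \notin closed_nbhd g D by case: arma.
case/cnP=> x; rewrite ssetE => xA bex.
have nalbe : eq_or_adj g al be = false by rewrite (notin_cn alB) // inE eqxx.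
have xpost : x \in post.
  by move: xA; rewrite inE => /predU1P[ex|//]; rewrite ex nb_sym nalbe in bex.
case: post ep arma bA nA xA xpost => // a1 t ep arma bA nA xA xpost.
(* The set [[set be] :|: D] touches [al] through [D] and a later vertex through [be], hence [a1];
   and [D] alone does not touch [a1]. *)
have a1be : eq_or_adj g a1 be.
  move: xpost; rewrite inE => /predU1P[<-|xt]; first by rewrite nb_sym.
  suff : a1 \in closed_nbhd g ([set be] :|: D).
    by rewrite cnU (negPf (nA a1 (mem_head _ _))) orbF cn1.
  apply: (loop_gap lp' (pre := rcons pre al) (a := a1) (post := t) _ _ _ _ _ xt (x := al)).
  - by rewrite cat_rcons.
  - by apply: (connU (x := be) (conn1 g (x := be))) => //; rewrite inE.
  - by rewrite !inE negb_or notinD_u // u_notinD.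
  - by rewrite mem_rcons inE eqxx.
  - by rewrite cnU alD orbT.
  - by rewrite cnU cn1 nb_sym bex.
have bnb : b != be by apply: contraTneq a1be => <-; rewrite nb_sym (notin_cn bA) // !inE eqxx orbT.
move: bpre; rewrite (negPf bnb) /= => bpre.
have [r1 [mid em]] : exists r1 mid, pre' = r1 ++ b :: mid.
  by case/splitPr: bpre => p1 p2; exists p1, p2.
have eq' : q' = r1 ++ b :: (mid ++ be :: post') by rewrite eq em -catA.
have er : rev q' = rev (mid ++ be :: post') ++ b :: rev r1 by rewrite eq' (rev_cat r1) rev_cons cat_rcons.
have salp : sorted (adj g) [:: al; a1].
  by move: (loop_sorted lp'); rewrite ep => /cat_sorted2[_] /= /andP[->].
exists p', (rev q'), al, (a1 :: t), b, (rev r1); split=> //.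
- split=> //; first by exists (rev (mid ++ be :: post')) => //; apply: loop_rev.
  move=> v; rewrite mem_rev => vr; apply/negP => vD.
  by apply: (loop_far lq' eq' vr vD _ beD); rewrite mem_cat inE eqxx orbT.
apply: notin_cnI => v; rewrite inE mem_rev => /predU1P[->|vr]; first by rewrite nb_sym; apply: negPf.
(* If [al] touched [v] before [b], the edge from [al] to [a1] would touch both [v] and [be], on the
   two sides of [b], hence [b] itself. *)
apply: contraTF bA => alv; rewrite negbK.
suff : b \in closed_nbhd g (sset [:: al; a1]).
  by case/cnP=> w; rewrite ssetE => ww bw; apply: (cnI _ bw); rewrite ssetE !inE; move: ww; rewrite !inE => /orP[]->; rewrite ?orbT.
apply: (loop_gap lq' eq' (conn_seq salp) _ vr (y := be)).
- have := loop_notin lp'; rewrite ep mem_cat !inE !negb_or.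
  by case/and4P=> _ -> ->.
- by apply: (cnI (y := al)); rewrite ?inE ?eqxx // nb_sym.
- by rewrite mem_cat inE eqxx orbT.
- by apply: (cnI (y := a1)); rewrite ?inE ?eqxx ?orbT // nb_sym.
Qed.

(** For two contacts that do not touch, the arms meet at [a1] and [b1]. Then the other side of [p']
    at [al] supplies a second arm, which must meet the arm of [be] at [b1] as well, although that
    side stays away from [b1]. *)
Lemma loops_clique p q a b : loop u p -> loop u q -> a \in p -> b \in q ->
  a \in closed_nbhd g D -> b \in closed_nbhd g D -> eq_or_adj g a b.
Proof.
move=> lp lq ap bq aD bD; apply: contraT => ab.
have [{lp ap}p' [{lq bq}q' [al [post [be [post' [arma armb alB beA]]]]]]] :=
  arms_exist lp lq ap bq aD bD ab.
have [a1 [t [b1 [t' [ea eb a1b1]]]]] := arms_meet arma armb alB beA.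
case: (arma) => [[pre lp ep] alD nA]; case: (armb) => [[pre' lq eq] beD nB].
subst post post'.
have sbe : sorted (adj g) [:: be; b1].
  by move: (loop_sorted lq); rewrite eq => /cat_sorted2[_] /= /andP[->].
have uq : u \notin sset [:: be; b1].
  have := loop_notin lq; rewrite eq mem_cat !inE !negb_or.
  by case/and4P=> _ -> ->.
(* Otherwise the edge from [be] to [b1] touches [x] before [al] and [a1] after it, hence [al]. *)
have far x : x \in pre -> x \notin closed_nbhd g (sset [:: be; b1]).
  move=> xp; apply: contra alB => xW.
  have : al \in closed_nbhd g (sset [:: be; b1]).
    apply: (loop_gap lp ep (conn_seq sbe) uq xp xW (y := a1)); first by rewrite inE eqxx.
    by apply: (cnI (y := b1)); rewrite ?inE ?eqxx ?orbT.
  by case/cnP=> w; rewrite ssetE => ww bw; apply: (cnI _ bw); rewrite ssetE !inE; move: ww; rewrite !inE => /orP[]->; rewrite ?orbT.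
have er : rev p' = rev (a1 :: t) ++ al :: rev pre by rewrite ep rev_cat rev_cons cat_rcons.
case: (boolP (has (mem (closed_nbhd g D)) (rev pre))) => [|np].
  case/split_last_has=> l [c [r [ec cD' nr]]].
  have sub x : x \in c :: r -> x \in pre by move=> xr; rewrite -mem_rev ec mem_cat xr orbT.
  have armc : arm (rev p') c r.
    split=> //; last by move=> x xr; apply: contra nr => xD; apply/hasP; exists x.
    by exists (rev (a1 :: t) ++ al :: l); [apply: loop_rev | rewrite er ec -catA].
  have cB : c \notin closed_nbhd g (sset [:: be, b1 & t']).
    have cpre := far c (sub c (mem_head _ _)).
    apply: notin_cnI => y; rewrite !inE orbA => /orP[yb|yt].
      by apply: (notin_cn cpre); rewrite !inE.
    apply/negP=> cy.
    (* The contact of [c] with [y] is pulled back along the arm of [be]: [D] reaches [be], and [b1]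
       lies between [be] and [y]. *)
    have : b1 \in closed_nbhd g ([set c] :|: D).
      apply: (loop_gap lq (pre := rcons pre' be) (a := b1) (post := t') _ _ _ _ _ yt (x := be)).
      - by rewrite cat_rcons.
      - by apply: (connU (x := c) (conn1 g (x := c))) => //; rewrite inE.
      - by rewrite !inE negb_or notinD_u // u_notinD.
      - by rewrite mem_rcons inE eqxx.
      - by rewrite cnU beD orbT.
      - by rewrite cnU cn1 nb_sym cy.
    rewrite cnU (negPf (nB b1 (mem_head _ _))) orbF cn1 nb_sym.
    by rewrite (notin_cn cpre) // !inE eqxx orbT.
  have beC : be \notin closed_nbhd g (sset (c :: r)).
    by apply: notin_cnI => y /sub/far yW; rewrite nb_sym (notin_cn yW) // inE eqxx.
  have [x [r' [b1' [t'' [ex [eb _] xb]]]]] := arms_meet armc armb cB beC.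
  subst r b1'; have /far xW : x \in pre by apply: sub; rewrite !inE eqxx orbT.
  by rewrite (notin_cn xW) // !inE eqxx orbT in xb.
have armc : arm (rev p') al (rev pre).
  split=> //; last by move=> x xr; apply: contra np => xD; apply/hasP; exists x.
  by exists (rev (a1 :: t)) => //; apply: loop_rev.
have beC : be \notin closed_nbhd g (sset (al :: rev pre)).
  apply: notin_cnI => y; rewrite inE mem_rev => /predU1P[->|/far yW].
    by rewrite (notin_cn beA) // inE eqxx.
  by rewrite nb_sym (notin_cn yW) // inE eqxx.
have [x [r' [b1' [t'' [ex [eb _] xb]]]]] := arms_meet armc armb alB beC.
subst b1'; have /far xW : x \in pre by rewrite -mem_rev ex mem_head.
by rewrite (notin_cn xW) // !inE eqxx orbT in xb.
Qed.

End Loops.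

(** * Local chordalization by an NC vertex only destroys holes *)

Section LocalChordalization.
Variable T : finType.
Implicit Types (g : graph T) (x y z u : T) (A B D W S C K : {set T}) (s p q : seq T).

Lemma hole_sub g S x : is_hole g S -> x \in S -> x \in gV g.
Proof.
move=> hS xS; have [q [_ _ _ _ [[a [m [b [eq _]]]] el _ _]]] := hole_path hS xS.
have [|//|y _ /and4P[]//] := el q [::]; first by rewrite cats0.
by rewrite eq.
Qed.

Lemma adj_locchord g u x y : adj (locchord g u) x y =
  adj g x y || (x != y) && [exists S : {set T}, [&& is_hole g S, u \in S &
     ((x == u) && (y \in S)) || ((y == u) && (x \in S))]].
Proof.
rewrite {1}/adj /= (adj_sym g y x).
case: (boolP (adj g x y)) => [xy|_] /=; first by case/and4P: xy => -> -> ->.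
apply/and4P/andP.
  case=> xV yV ne /orP[]/andP[/eqP e /existsP[S /and3P[hS uS iS]]];
  by split=> //; apply/existsP; exists S; rewrite hS uS e eqxx iS ?orbT.
case=> ne /existsP[S /and3P[hS uS H]]; split=> //.
- by case/orP: H => /andP[/eqP e iS]; rewrite (hole_sub hS) ?e.
- by case/orP: H => /andP[/eqP e iS]; rewrite (hole_sub hS) ?e.
- case/orP: H => /andP[-> iS] /=; apply/orP; [left|right]; apply/existsP; exists S; by rewrite hS uS.
Qed.

Lemma adj_locchord_neq g u x y : x != u -> y != u -> adj (locchord g u) x y = adj g x y.
Proof.
move=> xu yu; rewrite adj_locchord (negPf xu) (negPf yu).
case: existsP => [[S]|]; first by rewrite !andbF.
by rewrite andbF orbF.
Qed.

Lemma is_hole_eq g g' S : {in S &, adj g =2 adj g'} -> is_hole g S = is_hole g' S.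
Proof.
move=> H; rewrite /is_hole; congr (_ && _); apply: eq_existsb => t.
case: (boolP (uniq t && _)) => //= /andP[_ /eqP e].
have tS i : tnth t i \in S by have /setP/(_ (tnth t i)) <- := e; rewrite inE mem_tnth.
by apply: eq_forallb => i; apply: eq_forallb => j; rewrite H.
Qed.

(** Away from [u] nothing changes. If a hole of the new graph passed through [u], the interior [m]
    of its path would be a connected set off all old holes through [u] and not adjacent to [u], so
    [loops_clique] would join the path ends [a] and [b]. *)
Lemma locchord_hole g u S : nc_vertex g u -> is_hole (locchord g u) S ->
  is_hole g S && (u \notin S).
Proof.
move=> nc hS; case: (boolP (u \in S)) => [uS|uS]; last first.
  rewrite andbT -(is_hole_eq (g := locchord g u)) // => x y xS yS.
  by apply: adj_locchord_neq; [apply: contraTneq xS | apply: contraTneq yS] => ->.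
have [q [_ uuq so an [[a [m [b [eq m0]]]] el er mid]]] := hole_path hS uS.
exfalso.
have uq : u \notin q by case/andP: uuq.
have sog : sorted (adj g) q.
  have : all (predC1 u) q by apply/allP => x xq; apply: contraTneq xq => /= ->.
  move=> qu; apply: sub_in_sorted qu so => x y xu yu.
  by rewrite adj_locchord_neq.
have [ua ub] : adj (locchord g u) u a /\ adj (locchord g u) u b.
  have [||x] := el [:: a] (rcons m b) => //; rewrite inE => /eqP -> ?.
  have [||y] := er (a :: m) [:: b] => //; first by rewrite eq cats1.
  by rewrite inE => /eqP ->.
have midm x : x \in m -> ~~ adj (locchord g u) u x.
  move=> xm; have [s1 [s2 em]] : exists s1 s2, m = s1 ++ x :: s2.
    by case/splitPr: xm => s1 s2; exists s1, s2.
  apply: (mid (a :: s1) x (rcons s2 b)) => //; last by case: (s2).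
  by rewrite eq em rcons_cat.
(* An old neighbour of [u] is a trace by itself; a new one lies on the trace of an old hole through
   [u]. *)
have lp c : adj (locchord g u) u c -> exists2 p, loop g u p & c \in p.
  rewrite adj_locchord => /orP[uc|/andP[uc /existsP[S' /and3P[hS' uS' H]]]].
    by exists [:: c]; [apply: loop1 | rewrite inE].
  have cS' : c \in S' by move: H; rewrite eqxx eq_sym (negPf uc) orbF.
  have [p [lp eS]] := loop_hole nc hS' uS'; exists p => //.
  by move: cS'; rewrite -eS inE in_cons eq_sym (negPf uc).
have [p lpp ap] := lp a ua; have [p' lpp' bp] := lp b ub.
have cD : conn g [set x in m].
  apply: conn_seq; move: sog; rewrite eq /= -cats1 => /path_sorted.
  by rewrite -/(sorted _ _) => /cat_sorted2[].
have uD : u \notin closed_nbhd g [set x in m].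
  apply/cnP=> -[y]; rewrite inE => ym /orP[/eqP e|uy].
    by move: uq; rewrite eq inE mem_rcons inE e ym !orbT.
  by have := midm y ym; rewrite adj_locchord uy.
have noD S' x : is_hole g S' -> u \in S' -> x \in S' -> x \notin [set x in m].
  move=> hS' uS' xS'; rewrite inE; apply/negP => xm.
  have := midm x xm; rewrite adj_locchord negb_or => /andP[_].
  have -> /= : u != x by apply: contraNneq uq => ->; rewrite eq inE mem_rcons inE xm !orbT.
  by case/existsP; exists S'; rewrite hS' uS' eqxx xS'.
have ab : ~~ eq_or_adj (locchord g u) a b.
  case: m m0 eq {el er mid midm cD uD noD} => // c m _ eq.
  by apply: (an [:: a] c (rcons m b) eq); rewrite ?inE // mem_rcons inE eqxx.
have aD : a \in closed_nbhd g [set x in m].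
  case: m m0 eq {el er mid midm cD uD noD ab} => // c m _ eq.
  apply: (cnI (y := c)); first by rewrite !inE eqxx.
  by move: sog; rewrite eq /= => /andP[ac _]; rewrite /eq_or_adj ac orbT.
have bD : b \in closed_nbhd g [set x in m].
  case/lastP: m m0 eq {el er mid midm cD uD noD ab aD} => // m c _ eq.
  apply: (cnI (y := c)); first by rewrite inE mem_rcons inE eqxx.
  move: sog; rewrite eq -!cats1 /= -catA cat_path /= => /and4P[_ _ cb _].
  by rewrite nb_sym /eq_or_adj cb orbT.
have := loops_clique cD uD noD lpp lpp' ap bp aD bD.
case/orP=> [/eqP e|gab]; first by rewrite e nbxx in ab.
by move: ab; rewrite /eq_or_adj adj_locchord gab orbT.
Qed.

End LocalChordalization.

(** * Cliques after chordalizing by an NC set *)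

Section Hat.
Variable T : finType.
Implicit Types (g : graph T) (x y z u v w : T) (A B D W S C K U L : {set T}) (s p q l : seq T).

Lemma nc_vertex_locchord g u v :
  nc_vertex g u -> nc_vertex g v -> nc_vertex (locchord g u) v.
Proof.
move=> ncu; apply: contra => /existsP[S /existsP[S' /and5P[hS vS hS' vS' sh]]].
have [/andP[gS uS] /andP[gS' uS']] := (locchord_hole ncu hS, locchord_hole ncu hS').
apply/existsP; exists S; apply/existsP; exists S'; rewrite gS vS gS' vS' /=.
case/existsP: sh => a /existsP[b /existsP[c /and5P[ac ab bc aI /andP[bI cI]]]].
apply/existsP; exists a; apply/existsP; exists b; apply/existsP; exists c.
have neq x : x \in S :&: S' -> x != u by rewrite inE => /andP[xS _]; apply: contraTneq xS => ->.
by rewrite ac aI bI cI -!(@adj_locchord_neq _ g u) ?ab ?bc ?neq.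
Qed.

Lemma gV_foldl g l : gV (foldl (@locchord T) g l) = gV g.
Proof. by elim: l g => //= u l IH g; rewrite IH. Qed.

Lemma adj_foldl g l x y : adj g x y -> adj (foldl (@locchord T) g l) x y.
Proof. by elim: l g => //= u l IH g xy; apply: IH; rewrite adj_locchord xy. Qed.

(** An edge added at any stage comes from a hole of that stage, which is already a hole of the
    initial graph by [locchord_hole]. *)
Lemma foldl_adj g l x y : (forall u, u \in l -> nc_vertex g u) ->
  adj (foldl (@locchord T) g l) x y -> ~~ adj g x y ->
  exists S, [/\ is_hole g S, x \in S, y \in S & (x \in l) || (y \in l)].
Proof.
elim: l g => [|u l IH] g nc /=; first by move=> ->.
have ncu : nc_vertex g u by apply: nc; rewrite mem_head.
move=> H nxy; case: (boolP (adj (locchord g u) x y)) => [|nxy'].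
  rewrite adj_locchord (negPf nxy) /= => /andP[_ /existsP[S /and3P[hS uS H']]].
  exists S; rewrite !inE.
  by case/orP: H' => /andP[/eqP -> ->]; rewrite eqxx uS ?orbT.
have [|S [hS xS yS xyl]] := IH (locchord g u) _ H nxy'.
  by move=> v vl; apply: nc_vertex_locchord => //; apply: nc; rewrite inE vl orbT.
exists S; case/andP: (locchord_hole ncu hS) => -> _; split=> //.
by rewrite !inE; case/orP: xyl => ->; rewrite !orbT.
Qed.

Section OneStep.
Variables (g : graph T) (C : {set T}).
Hypothesis nc : nc_set g C.

Lemma nc_set_vertex u : u \in C -> nc_vertex g u.
Proof. by case/andP: nc => /forall_inP H _; apply: H. Qed.

Lemma nc_set_hole S u v : is_hole g S -> u \in S -> v \in S -> u \in C -> v \in C -> u = v.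
Proof.
case/andP: nc => _ /forallP/(_ S)/implyP H /H /card_le1_eqP e uS vS uC vC.
by apply: e; rewrite inE ?uS ?vS.
Qed.

Lemma hat_adj x y : adj (hat g C) x y -> ~~ adj g x y ->
  exists S, [/\ is_hole g S, x \in S, y \in S & (x \in C) || (y \in C)].
Proof.
move=> H nxy; have [|S [hS xS yS]] := foldl_adj _ H nxy.
  by move=> u; rewrite mem_enum; apply: nc_set_vertex.
by rewrite !mem_enum => xy; exists S.
Qed.

(** Take from [w] a side of [S1] not touched by [u2] and a side of [S2] not touched by [u1]. With
    [[set u2]] and the first side joined through the second, [hole_of_sets] at [u1] gives a hole
    containing two vertices of [C]. *)
Lemma no_common_new u1 u2 w S1 S2 : adj g u1 u2 -> u1 \in C -> u2 \in C -> w \notin C ->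
  is_hole g S1 -> u1 \in S1 -> w \in S1 -> ~~ adj g u1 w ->
  is_hole g S2 -> u2 \in S2 -> w \in S2 -> ~~ adj g u2 w -> False.
Proof.
move=> u12 u1C u2C wC h1 u1S wS1 nu1w h2 u2S wS2 nu2w.
have neq v : v \in C -> v != w by move=> vC; apply: contraNneq wC => <-.
have side u v S : u \in C -> v \in C -> u != v -> is_hole g S -> u \in S -> w \in S -> ~~ adj g v w ->
    exists p pre post, [/\ loop g u p, p = pre ++ w :: post & v \notin closed_nbhd g (sset (w :: post))].
  move=> uC vC uv hS uS wS nvw.
  have [p [lp eS]] := loop_hole (nc_set_vertex uC) hS uS.
  apply: (free_side lp) => //.
    by move: wS; rewrite -eS inE in_cons eq_sym (negPf (neq u uC)).
  by rewrite nb_sym negb_or neq.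
have [p1 [pre1 [post1 [l1 e1 n1]]]] := side _ _ _ u1C u2C (adj_neq u12) h1 u1S wS1 nu2w.
have u21 : u2 != u1 by rewrite eq_sym (adj_neq u12).
have [p2 [pre2 [post2 [l2 e2 n2]]]] := side _ _ _ u2C u1C u21 h2 u2S wS2 nu1w.
have cc p pre post : sorted (adj g) p -> p = pre ++ w :: post -> conn g (sset (w :: post)).
  by move=> so e; move: so; rewrite e => /cat_sorted2[_]; apply: conn_seq.
have [||||||||||S [hS u1S' _ [[x /setIP[xS]]]]] := @hole_of_sets _ g u1 [set u2]
  (sset (w :: post1)) (sset (w :: post2)) (conn1 g (x := u2)).
- exact: cc (loop_sorted l1) e1.
- exact: cc (loop_sorted l2) e2.
- by rewrite inE eq_sym.
- by have := loop_notin l1; rewrite e1 ssetE mem_cat negb_or => /andP[].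
- exact: n2.
- by move=> x y; rewrite inE ssetE => /eqP -> yA; rewrite (notin_cn n1).
- by exists u2; rewrite ?inE.
- by have [//|v vp uv] := loop_endr l1 e1; exists v; rewrite ?ssetE.
- exists u2; first by rewrite inE.
  have [//|v vp uv] := loop_endr l2 e2; apply: (cnI (y := v)); first by rewrite ssetE.
  by rewrite /eq_or_adj uv orbT.
- by exists w; rewrite ?ssetE ?mem_head // sub_cn // ssetE mem_head.
rewrite inE => /eqP ex; rewrite ex in xS => _ _ _.
by move: (adj_neq u12); rewrite (nc_set_hole hS u1S' xS) ?eqxx.
Qed.

(** All pairs of [K] that were not adjacent before share their end in [C]; [U] consists of that
    vertex, or is empty if there are no such pairs. *)
Lemma hat_clique K : is_clique (hat g C) K ->
  exists U, #|U| <= 1 /\ is_clique g (K :\: U).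
Proof.
case/andP=> Kg /forall_inP clK.
have KV : K \subset gV g by rewrite /hat gV_foldl in Kg.
have clK' x y : x \in K -> y \in K -> x != y -> adj (hat g C) x y.
  by move=> xK yK; move/forall_inP: (clK x xK) => /(_ y yK)/implyP.
(* New pairs are oriented from [C]; the other end is outside [C], since a hole has at most one
   vertex in [C]. *)
pose new u w := [&& u \in K, u \in C, w \in K, u != w & ~~ adj g u w].
have newP u w : new u w -> w \notin C /\ exists S, [/\ is_hole g S, u \in S & w \in S].
  case/and5P=> uK uC wK uw nuw.
  have [S [hS uS wS _]] := hat_adj (clK' _ _ uK wK uw) nuw.
  split; last by exists S.
  by apply: contraNN uw => wC; apply/eqP; apply: (nc_set_hole hS).
have oldP x y : x \in K -> y \in K -> x != y -> ~~ adj g x y -> new x y || new y x.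
  move=> xK yK xy nxy; have [S [_ _ _ H]] := hat_adj (clK' _ _ xK yK xy) nxy.
  by rewrite /new xK yK xy eq_sym xy (adj_sym g y) nxy !andbT.
have uniq_new u1 w1 u2 w2 : new u1 w1 -> new u2 w2 -> u1 = u2.
  move=> n1 n2; apply/eqP; apply: contraT => u12.
  have [w1C [S1 [h1 u1S w1S]]] := newP _ _ n1; have [w2C [S2 [h2 u2S w2S]]] := newP _ _ n2.
  case/and5P: (n1) => u1K u1C w1K uw1 nuw1; case/and5P: (n2) => u2K u2C w2K uw2 nuw2.
  have u12a : adj g u1 u2.
    apply: contraT => nu; have := oldP _ _ u1K u2K u12 nu.
    by case/orP=> /newP[]; rewrite ?u1C ?u2C.
  have key w : w \in K -> w \notin C -> new u1 w -> new u2 w -> False.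
    move=> wK wC m1 m2.
    have [_ [S [hS ? ?]]] := newP _ _ m1; have [_ [S' [hS' ? ?]]] := newP _ _ m2.
    case/and5P: m1 => _ _ _ _ ?; case/and5P: m2 => _ _ _ _ ?.
    exact: (no_common_new u12a u1C u2C wC (S1 := S) (S2 := S')).
  have old1 : adj g u2 w1.
    apply: contraT => nu; case: (key w1 w1K w1C n1).
    by rewrite /new u2K u2C w1K nu andbT; apply: contraNneq w1C => <-.
  have old2 : adj g u1 w2.
    apply: contraT => nu; case: (key w2 w2K w2C _ n2).
    by rewrite /new u1K u1C w2K nu andbT; apply: contraNneq w2C => <-.
  have w12 : adj g w1 w2.
    apply: contraT => nw.
    have ne : w1 != w2 by apply: contraNneq nuw1 => ->.
    by have := oldP _ _ w1K w2K ne nw; rewrite /new (negPf w1C) (negPf w2C) /= !andbF.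
  (* Now [u1], [u2], [w1], [w2] form a 4-cycle of [g] with both diagonals missing: a hole with two
     vertices in [C]. *)
  have [||||||||S [hS u1S' _ [[x /setIP[xS]]]]] := @hole_of_sets _ g u1 [set u2] [set w2] [set w1]
    (conn1 g (x := u2)) (conn1 g (x := w2)) (conn1 g (x := w1)).
  - by rewrite inE.
  - by rewrite inE (adj_neq old2).
  - by rewrite cn1 negb_or uw1.
  - by move=> x y; rewrite !inE => /eqP -> /eqP ->; rewrite negb_or uw2.
  - by exists u2; rewrite ?inE.
  - by exists w2; rewrite ?inE.
  - by exists u2; rewrite ?cn1 ?inE // /eq_or_adj old1 orbT.
  - by exists w2; rewrite ?cn1 ?inE // nb_sym /eq_or_adj w12 orbT.
  rewrite inE => /eqP ex; rewrite ex in xS => _ _ _.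
  by move: u12; rewrite (nc_set_hole hS u1S' xS) ?eqxx.
have mk U : #|U| <= 1 -> (forall u w, new u w -> u \in U) ->
    exists U, #|U| <= 1 /\ is_clique g (K :\: U).
  move=> U1 HU; exists U; split=> //; apply/andP; split.
    exact: subset_trans (subsetDl _ _) KV.
  apply/forall_inP=> x /setDP[xK xU]; apply/forall_inP=> y /setDP[yK yU]; apply/implyP=> xy.
  apply: contraT => nxy; case/orP: (oldP _ _ xK yK xy nxy) => /HU; last by rewrite (negPf yU).
  by rewrite (negPf xU).
case: (boolP [exists u, exists w, new u w]) => [/existsP[u /existsP[w uw]]|no].
  apply: (mk [set u]); first by rewrite cards1.
  by move=> u' w' n'; rewrite inE (uniq_new _ _ _ _ n' uw).
apply: (mk set0); first by rewrite cards0.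
by move=> u w uw; case/existsP: no; exists u; apply/existsP; exists w.
Qed.

End OneStep.
End Hat.

(** * Following a clique down the chordalization chain *)

Section Chain.
Variable T : finType.
Implicit Types (g : graph T) (x y z u v w : T) (A B D W S C K U L : {set T}) (P : seq {set T}).

Lemma in_bigcup_seq P x : (x \in \bigcup_(Y <- P) Y) = has (fun Y : {set T} => x \in Y) P.
Proof. by elim: P => [|Y P IH]; rewrite ?big_nil ?big_cons inE //= IH. Qed.

Lemma chainstep_adj g P Gp n x y : adj (chainstep g P Gp n) x y -> adj Gp x y || adj g x y.
Proof.
have dl X a b : adj (gdel g X) a b -> adj g a b.
  by rewrite /adj /= !inE => /and4P[/andP[_ ->] /andP[_ ->] -> ->].
case/and4P=> _ _ _ /orP[]/orP[H|/dl H]; first by rewrite H.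
- by rewrite H orbT.
- by rewrite adj_sym H.
- by rewrite (adj_sym g) H orbT.
Qed.

(** Later parts of the partition are still absent at stage [i], so deleting them from [g] removes no
    edge between present vertices. *)
Lemma gV_chainstar g C P i x : lcp g C P -> i <= size P ->
  x \in gV (chainstar g C P i) -> x \in gV g /\ x \notin \bigcup_(Y <- drop i P) Y.
Proof.
move=> [/and3P[_ CV _] [_ [dis [eC _]]]]; elim: i => [|i IH] iP.
  by rewrite drop0 eC /= inE => /andP[].
rewrite /= /hat gV_foldl /= inE => /orP[/(IH (ltnW iP))[-> ]|xi].
  by rewrite (drop_nth set0 iP) big_cons inE negb_or => /andP[].
split.
  apply: (subsetP CV); rewrite -eC in_bigcup_seq; apply/hasP.
  by exists (nth set0 P i) => //; apply: mem_nth.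
rewrite in_bigcup_seq; apply/hasP=> -[Y /(nthP set0)[j]].
rewrite size_drop nth_drop => jP <- xj.
have /disjointFr : [disjoint nth set0 P i & nth set0 P (i.+1 + j)].
  apply: dis => //; first by rewrite -ltn_subRL.
  by clear; lia.
by move/(_ x xi); rewrite xj.
Qed.

(* Edges of [g] leaving the vertex set of [h] are allowed, so that a clique of the last
   graph of the chain can be followed down the chain without restricting it. *)
Definition mixed g (h : graph T) K := forall x y, x \in K -> y \in K -> x != y ->
  adj g x y || adj h x y.

Lemma adj_chainstep g C P i x y : lcp g C P -> i < size P ->
  let Gi := chainstep g P (chainstar g C P i) i in
  x \in gV Gi -> y \in gV Gi -> adj g x y -> adj Gi x y.
Proof.
move=> lc iP Gi xV yV xy.
have V z : z \in gV Gi -> z \in gV g /\ z \notin \bigcup_(Y <- drop i.+1 P) Y.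
  by move=> zV; apply: (gV_chainstar lc iP); rewrite /= /hat gV_foldl.
have [xg xn] := V x xV; have [yg yn] := V y yV.
rewrite /adj xV yV (adj_neq xy) /=.
have -> : adj (gdel g (\bigcup_(Y <- drop i.+1 P) Y)) x y.
  by move: xy; rewrite /adj /= !in_setD xn yn.
by rewrite orbT.
Qed.

Lemma mixed_clique g C P i K : lcp g C P -> i < size P ->
  mixed g (chainstar g C P i.+1) K ->
  is_clique (chainstar g C P i.+1) (K :&: gV (chainstep g P (chainstar g C P i) i)).
Proof.
move=> lc iP mK; apply/andP; split.
  by rewrite /= /hat gV_foldl subsetIr.
apply/forall_inP=> x /setIP[xK xV]; apply/forall_inP=> y /setIP[yK yV]; apply/implyP=> xy.
case/orP: (mK x y xK yK xy) => // gxy.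
by apply: adj_foldl; apply: (adj_chainstep lc).
Qed.

(** Pairs inside the current vertex set are handled by [hat_clique]; any pair leaving it is an edge
    of [g] and survives for free. *)
Lemma mixed_step g C P i K : lcp g C P -> i < size P ->
  mixed g (chainstar g C P i.+1) K ->
  exists U, #|U| <= 1 /\ mixed g (chainstar g C P i) (K :\: U).
Proof.
move=> lc iP mK; have clK := mixed_clique lc iP mK.
have nc : nc_set (chainstep g P (chainstar g C P i) i) (nth set0 P i).
  by case: lc => _ [_ [_ [_ /(_ i iP)[]]]].
have [U [U1 /andP[_ /forall_inP clU]]] := hat_clique nc clK.
exists U; split=> // x y /setDP[xK xU] /setDP[yK yU] xy.
set Gi := chainstep _ _ _ _ in clK nc clU.
case/orP: (mK x y xK yK xy) => [-> //|sxy].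
have [xV yV] : x \in gV Gi /\ y \in gV Gi.
  by case/and4P: sxy; rewrite /= /hat !gV_foldl.
have xI : x \in (K :&: gV Gi) :\: U by rewrite !in_setD in_setI xK xU xV.
have yI : y \in (K :&: gV Gi) :\: U by rewrite !in_setD in_setI yK yU yV.
have /implyP/(_ xy)/chainstep_adj := forall_inP (clU x xI) y yI.
by rewrite orbC.
Qed.

Lemma mixed_iter g C P i d K : lcp g C P -> i + d <= size P ->
  mixed g (chainstar g C P (i + d)) K ->
  exists K', [/\ K' \subset K, #|K| <= #|K'| + d & mixed g (chainstar g C P i) K'].
Proof.
move=> lc; elim: d K => [|d IH] K.
  by rewrite addn0 => _ mK; exists K; rewrite addn0.
rewrite addnS => iP /(mixed_step lc iP)[U [U1 mU]].
have [K' [K'K cK mK']] := IH _ (ltnW iP) mU.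
exists K'; split=> //; first exact: subset_trans K'K (subsetDl _ _).
have := cardsID U K; have : #|K :&: U| <= 1 by apply: leq_trans U1; apply/subset_leq_card/subsetIr.
by move: cK; clear; lia.
Qed.

(** * Complete minors from almost complete sets *)

Lemma connect_component g W u x : connect (adj (induced g W)) u x ->
  connect (adj (induced g [set v | connect (adj (induced g W)) u v])) u x.
Proof.
case/connectP=> p; elim/last_ind: p x => [|p y IH] x; first by move=> _ ->.
rewrite rcons_path last_rcons => /andP[pp ly] ->.
apply: connect_trans (IH _ pp erefl) (connect1 _).
have cl : connect (adj (induced g W)) u (last u p) by apply/connectP; exists p.
rewrite adj_induced !inE cl (connect_trans cl (connect1 ly)) !andbT.
by move: ly; rewrite adj_induced => /and3P[].
Qed.

(** Branch sets: the component [B] of [u] outside [K :\ u], and singletons for the other vertices of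
    [K]. *)
Lemma clique_minor g K u : u \in K -> K \subset gV g ->
  (forall x y, x \in K :\ u -> y \in K :\ u -> x != y -> adj g x y) ->
  (forall w, w \in K :\ u -> exists2 x,
     connect (adj (induced g (~: (K :\ u)))) u x & adj g x w) ->
  has_Kminor g #|K|.
Proof.
move=> uK KV cl H.
set B := [set v | connect (adj (induced g (~: (K :\ u)))) u v].
have uB : u \in B by rewrite inE connect0.
have BK x : x \in B -> x \notin K :\ u.
  rewrite inE => /connectP[p]; case/lastP: p => [_ ->|p y]; first by rewrite !inE eqxx.
  rewrite rcons_path last_rcons => /andP[_ ly] ->.
  by move: ly; rewrite adj_induced => /and3P[_ _]; rewrite in_setC.
have BV x : x \in B -> x \in gV g.
  rewrite inE => /connectP[p]; case/lastP: p => [_ ->|p y]; first exact: (subsetP KV).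
  rewrite rcons_path last_rcons => /andP[_ ly] ->.
  by move: ly; rewrite adj_induced => /and3P[/and4P[]].
have cB : conn g B.
  have sym : connect_sym (adj (induced g B)) by apply: sym_connect_sym => a b; apply: adj_sym.
  move=> x y; rewrite !inE => /connect_component ux /connect_component uy.
  by apply: connect_trans uy; rewrite sym.
pose F (v : T) := if v == u then B else [set v].
(* Membership in [K :\ u] tells the singletons from [B], which gives disjointness. *)
have FK x v : v \in K -> x \in F v -> (x \in K :\ u) = (v != u).
  rewrite /F => vK; case: eqP => [_ /BK/negPf //|/eqP vu]; rewrite inE => /eqP ->.
  by rewrite !inE vu.
exists (fun i : 'I_#|K| => F (enum_val i)); split; [|split; [|split]].
- move=> i; have iK := enum_valP i; rewrite /F; case: (enum_val i =P u) => [e|_].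
    by split; [apply/set0Pn; exists u | apply/subsetP].
  by split; [apply/set0Pn; exists (enum_val i); rewrite inE | rewrite sub1set (subsetP KV)].
- by move=> i; rewrite /F; case: eqP => _; [exact: cB | exact: conn1].
- move=> i j; rewrite -(inj_eq enum_val_inj) => ij.
  rewrite -setI_eq0; apply/eqP/setP=> x; rewrite !inE; apply/andP=> -[xi xj].
  have := FK _ _ (enum_valP i) xi; rewrite (FK _ _ (enum_valP j) xj).
  move: ij xi xj; rewrite /F.
  case: (enum_val i =P u) => [->|_]; case: (enum_val j =P u) => [->|_] //.
    by rewrite eqxx.
  by move=> ij; rewrite !inE => /eqP -> /eqP e; rewrite e eqxx in ij.
- move=> i j; rewrite -(inj_eq enum_val_inj).
  move: (enum_val i) (enum_val j) (enum_valP i) (enum_valP j) => v w vK wK vw.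
  (* At most one of the two branch sets is [B]; by symmetry it is the first. *)
  wlog wu : v w vK wK vw / w != u.
    move=> W; case: (eqVneq w u) => [e|]; last exact: W.
    have [||||x [y [xw yv xy]]] := W w v; rewrite // ?(eq_sym w) // -?e //.
    by exists y, x; rewrite adj_sym.
  have wI : w \in K :\ u by rewrite !inE wu.
  rewrite /F (negPf wu); case: (eqVneq v u) => [_|vu].
    have [x ux xw] := H w wI; exists x, w; split=> //; rewrite ?inE //.
  exists v, w; rewrite !inE !eqxx; split=> //; apply: cl => //.
  by rewrite !inE vu.
Qed.

Lemma has_Kminor_leq g n m : n <= m -> has_Kminor g m -> has_Kminor g n.
Proof.
move=> nm [B [H1 [H2 [H3 H4]]]]; exists (fun i => B (widen_ord nm i)).
by split; [|split; [|split]] => i; [exact: H1 | exact: H2 | |] => j ij; [apply: H3 | apply: H4].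
Qed.

(** The two sides of [w] on the path left by removing [u] do not touch, so the clique formed by [L]
    on [S] meets at most one. The free side leads from [u] to a neighbour of [w]; if it is empty,
    [w] is an end of the path and [u] itself serves. *)
Lemma hole_side g S u w L : is_hole g S -> u \in S -> w \in S -> u != w -> u \notin L ->
  (forall x y, x \in L -> y \in L -> x \in S -> y \in S -> x != y -> adj g x y) ->
  exists2 x, connect (adj (induced g (~: L))) u x & adj g x w.
Proof.
move=> hS uS wS uw uL cl.
have [q [eS uuq so an [_ el er _]]] := hole_path hS uS.
have wq : w \in q by move: wS; rewrite -eS inE in_cons eq_sym (negPf uw).
have qS x : x \in q -> x \in S by move=> xq; rewrite -eS inE in_cons xq orbT.
have [pre [post eq]] : exists pre post, q = pre ++ w :: post.
  by case/splitPr: wq => p1 p2; exists p1, p2.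
have side s : sorted (adj g) s -> ~~ has (mem L) s -> (exists2 v, v \in s & adj g u v) ->
    (exists2 x, x \in s & adj g x w) ->
    exists2 x, connect (adj (induced g (~: L))) u x & adj g x w.
  move=> ss nL [v vs uv] [x xs xw]; exists x => //.
  have sub : u |: sset s \subset ~: L.
    apply/subsetP=> y; rewrite in_setU1 ssetE in_setC => /predU1P[->//|ys].
    by apply: contra nL => yL; apply/hasP; exists y.
  apply: (connect_induced_sub sub); apply: (connU (x := u) (conn1 g (x := u)) (conn_seq ss)).
  - by rewrite inE.
  - by apply: (cnI (y := v)); rewrite ?ssetE // /eq_or_adj uv orbT.
  - by rewrite in_setU1 eqxx.
  - by rewrite in_setU1 inE xs orbT.
move: (so); rewrite eq => /cat_sorted2[spre sp].
case: (boolP (has (mem L) post)) => [/hasP[y yp yL]|npost].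
  case: (lastP pre) eq spre => [|pre' c] eq spre.
    have [//|v] := el [:: w] post eq; rewrite inE => /eqP -> ?.
    by exists u.
  apply: (side (rcons pre' c)) => //.
  - apply/hasP=> -[x xp xL].
    have := an _ _ _ eq x y xp yp; rewrite negb_or => /andP[xy]; apply/negP; rewrite negbK.
    by apply: cl => //; apply: qS; rewrite eq mem_cat ?xp // inE yp !orbT.
  - by apply: el eq _; case: (pre').
  - exists c; first by rewrite mem_rcons mem_head.
    by move: so; rewrite eq -cats1 -catA sorted_cat_cons => /andP[_] /= /andP[].
case: post eq sp npost => [|c post] eq sp npost.
  have [//|v] := er pre [:: w] eq; rewrite inE => /eqP -> ?.
  by exists u.
apply: (side (c :: post)) => //; first exact: path_sorted sp.
  by apply: (er (rcons pre w)) => //; rewrite cat_rcons.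
by exists c; rewrite ?mem_head //; case/andP: sp; rewrite adj_sym.
Qed.

(** Undoing the first step costs one vertex of a clique, but contracting a component around that
    vertex recovers it for the minor. *)
Lemma mixed_minor g C P K : lcp g C P -> 0 < size P -> K \subset gV g ->
  mixed g (chainstar g C P 1) K -> has_Kminor g #|K|.
Proof.
move=> lc P0 KV mK.
have [->|[u0 u0K]] := set_0Vmem K.
  by rewrite cards0; exists (fun=> set0); split; [|split; [|split]] => -[].
have [U [U1 mU]] := mixed_step lc P0 mK.
have sub0 x y : adj g x y || adj (chainstar g C P 0) x y -> adj g x y.
  case/orP=> //; rewrite /adj /= !inE.
  by case/and4P=> /andP[_ ->] /andP[_ ->] -> ->.
(* If no vertex of [K] was removed, [K] is a clique of [g] and any vertex can play the part of
   [u]. *)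
have [u uK cl] : exists2 u, u \in K &
    forall x y, x \in K :\ u -> y \in K :\ u -> x != y -> adj g x y.
  have [e|[u /setIP[uK uU]]] := set_0Vmem (K :&: U).
    exists u0 => // x y /setD1P[_ xK] /setD1P[_ yK] xy; apply/sub0/mU => //.
      by rewrite inE xK andbT; apply: contraFN (in_set0 x) => xU; rewrite -e inE xK.
    by rewrite inE yK andbT; apply: contraFN (in_set0 y) => yU; rewrite -e inE yK.
  have sU v : v \in U -> v = u by move=> vU; apply: (card_le1_eqP U1).
  exists u => // x y /setD1P[xu xK] /setD1P[yu yK] xy; apply/sub0/mU => //.
    by rewrite inE xK andbT; apply: contra xu => /sU ->.
  by rewrite inE yK andbT; apply: contra yu => /sU ->.
apply: (clique_minor uK KV cl) => w wK.
have [wu wK'] := setD1P wK.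
case: (boolP (adj g u w)) => [uw|nuw]; first by exists u; rewrite ?connect0.
set G1 := chainstep g P (chainstar g C P 0) 0.
have G1g x y : adj G1 x y -> adj g x y.
  by move/chainstep_adj; rewrite orbC; apply: sub0.
have nc : nc_set G1 (nth set0 P 0).
  by case: lc => _ [_ [_ [_ /(_ 0 P0)[]]]].
have uw : u != w by rewrite eq_sym.
have suw : adj (hat G1 (nth set0 P 0)) u w.
  by have := mK u w uK wK' uw; rewrite (negPf nuw).
(* A missing neighbour [w] was joined to [u] in the first step, so both lie on a hole of [G1]; edges
   of [G1] are edges of [g], as the chain starts from [g] minus [C]. *)
have [S [hS uS wS _]] := hat_adj nc suw (contra (@G1g u w) nuw).
have uL : u \notin K :\ u by rewrite !inE eqxx.
have [|x ux xw] := hole_side hS uS wS uw uL.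
  move=> x y xK yK xS yS xy; apply: (adj_chainstep lc P0); try exact: hole_sub hS _.
  exact: cl.
exists x; last exact: G1g.
apply: (connect_sub _ ux) => a b; rewrite adj_induced => /and3P[ab aL bL].
by apply: connect1; rewrite adj_induced (G1g _ _ ab) aL.
Qed.

(** * The two bounds on the clique number *)

Lemma clique_mixed g h K : is_clique h K -> mixed g h K.
Proof.
by case/andP=> _ /forall_inP cl x y xK yK xy; rewrite (implyP (forall_inP (cl x xK) y yK) xy) orbT.
Qed.

Lemma lcp_size g C P : lcp g C P -> 0 < size P.
Proof.
case: P => // -[/and3P[C0 _ _] [_ [_ [eC _]]]].
by rewrite -eC big_nil eqxx in C0.
Qed.

(** All [size P] steps are undone; at stage 0 only edges of [g] remain. *)
Lemma omega_chainstar_induced g C P S : lcp g C P -> S \subset gV g ->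
  omega (induced (chainstar g C P (size P)) S) <= omega (induced g S) + size P.
Proof.
move=> lc SV; apply/bigmax_leqP => K /andP[KS /forall_inP cl].
have mK : mixed g (chainstar g C P (0 + size P)) K.
  move=> x y xK yK xy; have := implyP (forall_inP (cl x xK) y yK) xy.
  by rewrite adj_induced add0n => /and3P[-> _ _]; rewrite orbT.
have [//|K' [K'K cK m0]] := mixed_iter lc _ mK.
apply: leq_trans cK _; rewrite leq_add2r; apply: leq_bigmax_cond.
have K'S : K' \subset S.
  by apply: subset_trans K'K (subset_trans KS _); rewrite /= subsetIr.
apply/andP; split; first by rewrite /= subsetI K'S (subset_trans K'S).
apply/forall_inP=> x xK; apply/forall_inP=> y yK; apply/implyP=> xy.
rewrite adj_induced !(subsetP K'S) // !andbT.
case/orP: (m0 x y xK yK xy) => //; rewrite /adj /= !inE.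
by case/and4P=> /andP[_ ->] /andP[_ ->] -> ->.
Qed.

Lemma omega_chainstar_minor g C P n : lcp g C P -> ~ has_Kminor g n ->
  omega (chainstar g C P (size P)) <= n - 2 + size P.
Proof.
move=> lc noM; have P0 := lcp_size lc; apply/bigmax_leqP => K clK.
have eP : 1 + (size P).-1 = size P by rewrite add1n prednK.
have mK : mixed g (chainstar g C P (1 + (size P).-1)) K by rewrite eP; apply: clique_mixed.
have [|K' [K'K cK m1]] := mixed_iter lc _ mK; first by rewrite eP.
have KV : K \subset gV g.
  case/andP: clK => /subsetP KV _; apply/subsetP=> x /KV xV.
  by have [] := gV_chainstar lc (leqnn _) xV.
have M := mixed_minor lc P0 (subset_trans K'K KV) m1.
have lt : #|K'| < n by rewrite ltnNge; apply/negP => le; apply: noM; apply: has_Kminor_leq le M.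
(* Only [size P - 1] steps were undone and [#|K'| <= n - 1], which gives [n - 2 + size P]; for
   [n = 1] the truncated [n - 2] is 0 and the bound still follows. *)
by move: cK lt P0; clear; lia.
Qed.

End Chain.

Theorem theorem4p4 (T : finType) (g : graph T) (k : nat)
    (C : {set T}) (P : seq {set T}) (Gs : graph T) :
  nc_index g k ->
  ((chordal g /\ Gs = g) \/
   (lcp g C P /\ size P = k /\ Gs = chainstar g C P k)) ->
  (forall S : {set T}, S \subset gV g ->
     omega (induced Gs S) <= omega (induced g S) + k) /\
  (forall n : nat, ~~ chordal g -> ~ has_Kminor g n ->
     omega Gs <= n - 2 + k).
Proof.
move=> _ [[ch ->]|[lc [<- ->]]]; split.
- by move=> S _; apply: leq_addr.
- by move=> n; rewrite ch.
- by move=> S; apply: omega_chainstar_induced.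
- by move=> n _; apply: omega_chainstar_minor.
Qed.
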